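(* Let $d\ge 1$ and let $\mathbf{p}=(p_1,\dots,p_d)$ be a vector of nonzero real numbers. Then the collection $\mathcal{T}_d(\mathbf{p})$ of $d$-simplices in $\mathbb{R}^d$ constructed below is a simplicial tessellation of $\mathbb{R}^d$, so that $\mathbf{p}\mapsto\mathcal{T}_d(\mathbf{p})$ is a $d$-parametric family of simplicial tessellations. Every simplex $K\in\mathcal{T}_d(\mathbf{p})$ satisfies $$\operatorname{meas}_d K=\prod_{i=1}^d |p_i|.$$ Moreover, every connected compact subset of the tessellation (i.e. every finite subcollection of simplices of $\mathcal{T}_d(\mathbf{p})$ whose union is connected) is a face-to-face mesh.
   Context: Construction. Fix nonzero reals $p_1,\dots,p_d$. Inductively, for $m=1,\dots,d$, we define a collection $\mathcal{T}_m$ of $m$-simplices in $\mathbb{R}^m$ together with a coloring $c_m$ of their vertices by colors in $\{0,\dots,m\}$. (i) $m=1$: the vertices are $A_z=zp_1$, $z\in\mathbb{Z}$; the simplices are the segments between $zp_1$ and $(z+1)p_1$; the coloring is $c_1(A_z)=z \bmod 2$. (ii) Step $m-1\to m$ ($2\le m\le d$): put $c'=c_{m-1}$. For each $K\in\mathcal{T}_{m-1}$ label its vertices $A_0,\dots,A_{m-1}\in\mathbb{R}^{m-1}$ so that $c'(A_i)=i$. For $j\in\mathbb{Z}$ let $B^K_j=(A_{j \bmod m},\, jp_m)\in\mathbb{R}^m$ and for $z\in\mathbb{Z}$ let $L^{K,z}=\operatorname{conv}\{B^K_z,B^K_{z+1},\dots,B^K_{z+m}\}$ (convex hull of $m+1$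 consecutive points). Set $\mathcal{T}_m=\{L^{K,z}: K\in\mathcal{T}_{m-1},\ z\in\mathbb{Z}\}$. The vertices of $\mathcal{T}_m$ are the points $(A,jp_m)$ with $A$ a vertex of $\mathcal{T}_{m-1}$ and $j\equiv c'(A) \pmod m$, and they are colored by $c_m((A,jp_m))=j \bmod (m+1)$. Finally $\mathcal{T}_d(\mathbf{p}):=\mathcal{T}_d$. A simplicial tessellation of $\mathbb{R}^d$ is a collection of $d$-simplices covering $\mathbb{R}^d$ with pairwise disjoint interiors. A collection of simplices is a face-to-face mesh if any two of its simplices intersect either in the empty set or in a common face of both. $\operatorname{meas}_d$ denotes $d$-dimensional Lebesgue measure. *)

(* Defs.v *)
From HB Require Import structures.
From mathcomp Require Import all_boot all_order all_algebra.
From mathcomp Require Import all_classical all_reals all_analysis.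
Set Implicit Arguments. Unset Strict Implicit. Unset Printing Implicit Defensive.
Import Order.TTheory GRing.Theory Num.Theory.
Local Open Scope classical_set_scope.
Local Open Scope ring_scope.

Definition hull (R : realType) (n k : nat) (V : 'I_k -> 'rV[R]_n) : set 'rV[R]_n :=
  [set x | exists w : 'I_k -> R, (forall i, 0 <= w i) /\ \sum_i w i = 1 /\
           x = \sum_i w i *: V i].

Definition conv_sub (R : realType) (n k : nat) (V : 'I_k -> 'rV[R]_n)
  (I : {set 'I_k}) : set 'rV[R]_n :=
  [set x | exists w : 'I_k -> R, (forall i, 0 <= w i) /\
           (forall i, i \notin I -> w i = 0) /\ \sum_i w i = 1 /\
           x = \sum_i w i *: V i].

Definition aff_indep (R : realType) (n k : nat) (V : 'I_k -> 'rV[R]_n) : Prop :=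
  forall w : 'I_k -> R, \sum_i w i = 0 -> \sum_i w i *: V i = 0 ->
    forall i, w i = 0.

(** The d-simplex with vertex family V (V : 'I_(d+1) -> R^d affinely
    independent) is the set hull V; its faces are the convex hulls of the
    nonempty subfamilies of its vertices (the simplex itself included). *)
Definition is_face (R : realType) (d : nat) (V : 'I_d.+1 -> 'rV[R]_d)
  (F : set 'rV[R]_d) : Prop :=
  exists I : {set 'I_d.+1}, (0 < #|I|)%N /\ F = conv_sub V I.

Definition simplicial_tessellation (R : realType) (d : nat)
  (T : set ('I_d.+1 -> 'rV[R]_d)) : Prop :=
  (forall V, T V -> aff_indep V) /\
  (\bigcup_(V in T) hull V = setT) /\
  (forall V W, T V -> T W -> hull V <> hull W ->
     interior (hull V : set 'rV[R^o]_d) `&` interior (hull W : set 'rV[R^o]_d) = set0).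

Definition face_to_face (R : realType) (d : nat)
  (F : seq ('I_d.+1 -> 'rV[R]_d)) : Prop :=
  forall V W, V \in F -> W \in F ->
    hull V `&` hull W = set0 \/
    (is_face V (hull V `&` hull W) /\ is_face W (hull V `&` hull W)).

Definition cbox (R : realType) (d : nat) (a b : 'rV[R]_d) : set 'rV[R]_d :=
  [set x | forall i, a 0 i <= x 0 i <= b 0 i].

Definition lebesgue_outer (R : realType) (d : nat) (A : set 'rV[R]_d) : \bar R :=
  ereal_inf [set s | exists a b : nat -> 'rV[R]_d,
     (forall k i, a k 0 i <= b k 0 i) /\
     A `<=` \bigcup_k cbox (a k) (b k) /\
     s = (\sum_(0 <= k <oo) (\prod_i (b k 0 i - a k 0 i))%:E)%E].

Definition ext_pt (R : realType) (k : nat) (A : 'rV[R]_k) (t : R) : 'rV[R]_k.+1 :=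
  \row_(i < k.+1) (if unlift ord_max i is Some i' then A 0 i' else t).

(** (i) m = 1: segments between z p1 and (z+1) p1, vertices labelled by their
    colour c_1(A_j) = j mod 2 (vertex number i has colour i). *)
Definition T_base (R : realType) (p1 : R) : set ('I_2 -> 'rV[R]_1) :=
  [set W | exists z : int,
     W = fun i : 'I_2 => const_mx ((z + ((i%:Z - z) %% 2)%Z)%:~R * p1)].

(** (ii) step k -> k+1 (m = k+1): for K with vertices V_0..V_k (V_i of colour
    i), B_j = (V_(j mod (k+1)), j p_(k+1)), and L^{K,z} = conv{B_z,...,B_(z+k+1)},
    whose vertex of colour i (= j mod (k+2)) is B_j with z <= j <= z+k+1. *)
Definition B_pt (R : realType) (k : nat) (V : 'I_k.+1 -> 'rV[R]_k) (pm : R)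
  (j : int) : 'rV[R]_k.+1 :=
  ext_pt (V (inord `|(j %% k.+1%:Z)%Z|%N)) (j%:~R * pm).

Definition L_simplex (R : realType) (k : nat) (V : 'I_k.+1 -> 'rV[R]_k) (pm : R)
  (z : int) : 'I_k.+2 -> 'rV[R]_k.+1 :=
  fun i => B_pt V pm (z + ((i%:Z - z) %% k.+2%:Z)%Z).

Definition T_step (R : realType) (k : nat) (S : set ('I_k.+1 -> 'rV[R]_k))
  (pm : R) : set ('I_k.+2 -> 'rV[R]_k.+1) :=
  [set W | exists V z, S V /\ W = L_simplex V pm z].

(** T m p : the collection T_m (as coloured vertex families), for m >= 1,
    where p k (0-indexed) stands for p_(k+1).  T 0 p is unused. *)
Fixpoint T (R : realType) (p : nat -> R) (m : nat) : set ('I_m.+1 -> 'rV[R]_m) :=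
  match m with
  | 0 => set0
  | k.+1 =>
    match k as k0 return set ('I_k0.+1 -> 'rV[R]_k0) -> set ('I_k0.+2 -> 'rV[R]_k0.+1)
    with
    | 0 => fun _ => T_base (p 0%N)
    | k'.+1 => fun S => T_step S (p k'.+1)
    end (@T R p k)
  end.

(** Extension of p : 'I_d -> R to nat -> R (values beyond d are irrelevant). *)
Definition pext (R : realType) (d : nat) (p : 'I_d -> R) : nat -> R :=
  fun i => if insub i is Some j then p j else 0.

Definition Td (R : realType) (d : nat) (p : 'I_d -> R) : set ('I_d.+1 -> 'rV[R]_d) :=
  @T R (pext p) d.

(* Main.v *)
Require Import Defs.
From HB Require Import structures.
From mathcomp Require Import all_boot all_order all_algebra.
From mathcomp Require Import all_classical all_reals all_analysis.
From mathcomp Require Import zify ring lra.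
Set Implicit Arguments. Unset Strict Implicit. Unset Printing Implicit Defensive.
Import Order.TTheory GRing.Theory Num.Theory.
Local Open Scope classical_set_scope.
Local Open Scope ring_scope.

(** Each step of the construction is a statement about weights: a convex
    combination of the vertices of [L^{K,z}] is the same thing as its class sums
    modulo [m], which are barycentric coordinates in [K], together with its mean
    height.  The weight at a given height is a trapezoidal function of these data
    alone, not of [z]; by induction the barycentric coordinates are globally
    defined hat functions, so two simplices meet exactly in the hull of their
    common vertices.

    The same step shows that the integral combinations of the vertices of any
    simplex form one lattice, of which the box with sides [i |p_i|] is a
    fundamental cell, of volume [d! prod |p_i|].  A simplex contains
    [binomial (n + d) d ~ n^d / d!] points of the lattice scaled by [1/n], and an
    axis-parallel box contains as many of them as its volume divided by the
    volume of a scaled cell, up to a boundary term.  Counting them gives the lower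
    bound on the measure (after passing to finitely many open boxes by
    compactness), and covering by scaled cells gives the upper one. *)

(** * Residues and heights *)

Definition res (k : nat) (j : int) : 'I_k.+1 := inord `|(j %% k.+1%:Z)%Z|%N.

(** The unique integer in [z..z+k+1] congruent to [i] modulo [k+2]: the level of the vertex of
    colour [i], written exactly as inside [L_simplex]. *)
Definition height (k : nat) (z : int) (i : 'I_k.+2) : int :=
  z + ((i%:Z - z) %% k.+2%:Z)%Z.

Lemma res_val k j : (res k j)%:Z = (j %% k.+1%:Z)%Z.
Proof.
have h0 : 0 <= (j %% k.+1%:Z)%Z by rewrite modz_ge0.
have h1 : (j %% k.+1%:Z)%Z < k.+1%:Z by rewrite ltz_pmod.
by rewrite /res inordK ?gez0_abs //; lia.
Qed.

Lemma res_eq k j j' : (res k j == res k j') = (j == j' %[mod k.+1%:Z])%Z.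
Proof. by rewrite -val_eqE /= -(eqr_nat int) !natz !res_val. Qed.

Lemma res_ord k (i : 'I_k.+1) : res k i%:Z = i.
Proof. by apply/val_inj; rewrite /res /= modz_nat absz_nat modn_small // inordK. Qed.

Lemma res_add_period k j : res k (j + k.+1%:Z) = res k j.
Proof. by apply/eqP; rewrite res_eq modzDr. Qed.

Lemma res_window_inj k (z : int) : injective (fun o : 'I_k.+1 => res k (z + o%:Z)).
Proof.
move=> o o' /eqP; rewrite res_eq eqz_modDl !modz_nat !modn_small // => /eqP [].
by move/val_inj.
Qed.

Lemma sum_res (A : nmodType) k (z : int) (F : 'I_k.+1 -> A) :
  \sum_c F c = \sum_(o < k.+1) F (res k (z + o%:Z)).
Proof. by rewrite (reindex_inj (@res_window_inj k z)). Qed.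

Lemma height_bounds k z (i : 'I_k.+2) : z <= height z i <= z + k.+1%:Z.
Proof.
rewrite /height.
have h0 : 0 <= ((i%:Z - z) %% k.+2%:Z)%Z by rewrite modz_ge0.
have h1 : ((i%:Z - z) %% k.+2%:Z)%Z < k.+2%:Z by rewrite ltz_pmod.
lia.
Qed.

Lemma height_mod k z (i : 'I_k.+2) : (height z i = i%:Z %[mod k.+2%:Z])%Z.
Proof. by rewrite /height modzDmr addrC subrK. Qed.

Lemma res_height k z (i : 'I_k.+2) : res k.+1 (height z i) = i.
Proof. by rewrite -[RHS]res_ord; apply/eqP; rewrite res_eq height_mod. Qed.

Lemma height_res k z j : z <= j <= z + k.+1%:Z -> height z (res k.+1 j) = j.
Proof.
move=> h; rewrite /height res_val modzDml modz_small; first by lia.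
by lia.
Qed.

Lemma height_offset k z (o : 'I_k.+2) : height z (res k.+1 (z + o%:Z)) = z + o%:Z.
Proof. by apply: height_res; have := ltn_ord o; lia. Qed.

Lemma height_ex k z (i : 'I_k.+2) : exists o : 'I_k.+2, i = res k.+1 (z + o%:Z).
Proof.
have h := height_bounds z i.
have lo : (`|height z i - z| < k.+2)%N by lia.
exists (Ordinal lo) => /=; rewrite gez0_abs; last by lia.
by rewrite subrKC res_height.
Qed.

(** * Class sums of weights and their inversion *)

Section ClassSums.
Variables (A : pzRingType) (k : nat).
Implicit Types (z : int) (w : 'I_k.+2 -> A) (u : 'I_k.+1 -> A).

(** Among the heights [z..z+k+1] each class modulo [k+1] has one member, except the class of [z],
    which also contains [z+k+1]. The ring is general because real weights describe simplices and
    integer weights the lattice. *)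
Definition csum z w (c : 'I_k.+1) : A := \sum_(i | res k (height z i) == c) w i.

Definition mean z w : A := \sum_i w i * (height z i)%:~R.

(** The mean height when each class keeps its whole weight at its representative in [z..z+k]. *)
Definition base_mean z u : A :=
  \sum_(o < k.+1) u (res k (z + o%:Z)) * (z + o%:Z)%:~R.

Definition top_weight z w : A := w (res k.+1 (z + k.+1%:Z)).

(** Inverse of taking class sums: each class sits at its lowest height, except that [t] is moved
    from [z] up to [z+k+1]. *)
Definition spread z u (t : A) (i : 'I_k.+2) : A :=
  if height z i == z + k.+1%:Z then t
  else u (res k (height z i)) - (if height z i == z then t else 0).

Lemma sum_csum z w : \sum_c csum z w c = \sum_i w i.
Proof. by rewrite (partition_big (fun i => res k (height z i)) predT). Qed.

Lemma csum_res z w (o : 'I_k.+1) :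
  csum z w (res k (z + o%:Z)) =
  w (res k.+1 (z + o%:Z)) + (if o == ord0 then top_weight z w else 0).
Proof.
rewrite /csum big_mkcond (sum_res z) big_ord_recr /=; congr (_ + _).
  under eq_bigr do rewrite (@height_offset k z (widen_ord _ _))
    (inj_eq (@res_window_inj k z)).
  by rewrite -big_mkcond big_pred1_eq.
rewrite (@height_offset k z ord_max) /= res_add_period.
by rewrite -{1}[z]addr0 (inj_eq (@res_window_inj k z) ord0) eq_sym.
Qed.

Lemma mean_base z w :
  mean z w = base_mean z (csum z w) + k.+1%:R * top_weight z w.
Proof.
rewrite /mean /base_mean (sum_res z) big_ord_recr /=.
rewrite (@height_offset k z ord_max) /=.
under eq_bigr do rewrite (@height_offset k z (widen_ord _ _)) /=.
under [in RHS]eq_bigr do rewrite csum_res mulrDl.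
rewrite big_split /= -addrA; congr (_ + _).
rewrite big_ord_recl /= big1 ?addr0 => [|i _]; last by rewrite mul0r.
rewrite -/(top_weight z w) rmorphD /= mulrDr; congr (_ + _).
by rewrite -pmulrn mulr_natr mulr_natl.
Qed.

Lemma csum_spread z u t c : csum z (spread z u t) c = u c.
Proof.
have [l ->] : exists l : 'I_k.+1, c = res k (z + l%:Z).
  have [g _ gK] := injF_bij (@res_window_inj k z).
  by exists (g c).
rewrite csum_res /top_weight /spread (@height_offset k z ord_max) eqxx.
rewrite (@height_offset k z (widen_ord (leqnSn _) l)) /=.
have -> : (z + l%:Z == z + k.+1%:Z) = false by have := ltn_ord l; lia.
have -> : (z + l%:Z == z) = (l == ord0) by rewrite -val_eqE /=; lia.
by case: ifP => _; rewrite ?subr0 ?addr0 // subrK.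
Qed.

Lemma top_weight_spread z u t : top_weight z (spread z u t) = t.
Proof. by rewrite /top_weight /spread (@height_offset k z ord_max) eqxx. Qed.

Lemma eq_base_mean z u u' : u =1 u' -> base_mean z u = base_mean z u'.
Proof. by move=> e; apply: eq_bigr => o _; rewrite e. Qed.

Lemma mean_spread z u t :
  mean z (spread z u t) = base_mean z u + k.+1%:R * t.
Proof.
rewrite mean_base top_weight_spread; congr (_ + _).
by apply: eq_base_mean => c; rewrite csum_spread.
Qed.

Lemma sum_spread z u t : \sum_i spread z u t i = \sum_c u c.
Proof. by rewrite -(sum_csum z); apply: eq_bigr => c _; rewrite csum_spread. Qed.

Lemma base_mean_succ z u :
  base_mean (z + 1) u = base_mean z u + k.+1%:R * u (res k z).
Proof.
apply: (addrI (u (res k z) * z%:~R)).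
(* Both sides are the sum over the [k+2] heights [z..z+k+1], split at its first or at its last
   term. *)
pose F (o : nat) := u (res k (z + o%:Z)) * (z + o%:Z)%:~R.
have -> : u (res k z) * z%:~R + base_mean (z + 1) u = \sum_(o < k.+2) F o.
  rewrite big_ord_recl /F addr0; congr (_ + _); apply: eq_bigr => o _.
  by rewrite lift0 -addrA.
rewrite big_ord_recr /= {2}/F res_add_period rmorphD /= mulrDr -pmulrn.
by rewrite mulr_natr mulr_natl !addrA; congr (_ + _); rewrite addrC.
Qed.

Lemma spreadE z w : w =1 spread z (csum z w) (top_weight z w).
Proof.
move=> i; have [l ->] := height_ex z i; rewrite /spread height_offset.
case: (unliftP ord_max l) => [l' ->|->] /=; last by rewrite eqxx.
rewrite /bump leqNgt ltn_ord add0n csum_res.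
have -> : (z + l'%:Z == z + k.+1%:Z) = false by have := ltn_ord l'; lia.
have -> : (z + l'%:Z == z) = (l' == ord0) by rewrite -val_eqE /=; lia.
by rewrite addrK.
Qed.

End ClassSums.

(** * Recovering weights from class sums and mean *)

Section Hat.
Variables (R : archiRealFieldType) (k : nat).
Implicit Types (z j : int) (w : 'I_k.+2 -> R) (u : 'I_k.+1 -> R) (s : R).

Lemma csum_ge0 z w : (forall i, 0 <= w i) -> forall c, 0 <= csum z w c.
Proof. by move=> w0 c; apply: sumr_ge0. Qed.

Lemma base_mean_homo u : (forall c, 0 <= u c) ->
  forall z z', z <= z' -> base_mean z u <= base_mean z' u.
Proof.
move=> u0 z z' zz'; have -> : z' = z + `|z' - z|%N%:Z by lia.
elim: `|z' - z|%N => [|n IHn]; first by rewrite addr0.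
apply: le_trans IHn _; have -> : z + n.+1%:Z = z + n%:Z + 1 by lia.
by rewrite base_mean_succ lerDl mulr_ge0.
Qed.

Lemma base_mean_bounds u z : (forall c, 0 <= u c) -> \sum_c u c = 1 ->
  z%:~R <= base_mean z u <= (z + k%:Z)%:~R.
Proof.
move=> u0 u1; rewrite /base_mean.
have E (a : R) : a = \sum_(o < k.+1) u (res k (z + o%:Z)) * a.
  by rewrite -mulr_suml -sum_res u1 mul1r.
rewrite {1}(E z%:~R) (E (z + k%:Z)%:~R).
by apply/andP; split; apply: ler_sum => o _; apply: ler_wpM2l => //;
  rewrite ler_int; have := ltn_ord o; lia.
Qed.

(** The values [base_mean z u] are nondecreasing and unbounded both ways, so their steps cover the
    line. *)
Lemma base_mean_window u s : (forall c, 0 <= u c) -> \sum_c u c = 1 ->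
  exists z, base_mean z u <= s <= base_mean (z + 1) u.
Proof.
(* [base_mean a u] is at most [a + k], which is [floor s] for this start. *)
move=> u0 u1; pose a := Num.floor s - k%:Z.
have sa : base_mean a u <= s.
  apply: le_trans (floor_le s).
  by have /andP[_] := base_mean_bounds a u0 u1; rewrite {2}/a subrK.
have ex : exists n : nat, s < base_mean (a + n%:Z) u.
  exists k.+1; apply: lt_le_trans (floorD1_gt s) _.
  have -> : Num.floor s + 1 = a + k.+1%:Z by rewrite /a; ring.
  by have /andP[] := base_mean_bounds (a + k.+1%:Z) u0 u1.
case: (ex_minnP ex) => -[|n] sn nmin; first by move: sn; rewrite addr0 ltNge sa.
exists (a + n%:Z); apply/andP; split.
  by rewrite leNgt; apply/negP => /nmin; rewrite ltnn.
by have -> : a + n%:Z + 1 = a + n.+1%:Z; [rewrite -addrA -PoszD addn1 | exact: ltW].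
Qed.

Lemma top_weight_bounds z w : (forall i, 0 <= w i) ->
  0 <= top_weight z w <= csum z w (res k z).
Proof.
move=> w0; rewrite /top_weight w0 /=.
have := csum_res z w ord0; rewrite eqxx addr0 => ->.
by rewrite lerDr.
Qed.

Lemma mean_window z w : (forall i, 0 <= w i) ->
  base_mean z (csum z w) <= mean z w <= base_mean (z + 1) (csum z w).
Proof.
move=> w0; have /andP[t0 t1] := top_weight_bounds z w0.
by rewrite mean_base base_mean_succ lerDl lerD2l mulr_ge0 // ler_pM2l ?ltr0n.
Qed.

Lemma spread_ge0 z u t : (forall c, 0 <= u c) -> 0 <= t <= u (res k z) ->
  forall i, 0 <= spread z u t i.
Proof.
move=> u0 /andP[t0 tu] i; rewrite /spread; case: ifP => // _.
by case: eqP => [->|_]; rewrite subr_ge0.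
Qed.

(** For nonnegative [u], the length of the part below [s] of the step from [base_mean j u] to
    [base_mean (j + 1) u]. *)
Definition ramp u s j : R :=
  Num.min (Num.max (s - base_mean j u) 0) (k.+1%:R * u (res k j)).

Lemma ramp_val u s z j : (forall c, 0 <= u c) ->
  base_mean z u <= s <= base_mean (z + 1) u ->
  ramp u s j = if j < z then k.+1%:R * u (res k j)
               else if j == z then s - base_mean z u else 0.
Proof.
move=> u0 /andP[s0 s1]; rewrite /ramp.
have ku : 0 <= k.+1%:R * u (res k j) by rewrite mulr_ge0.
case: ltgtP => [jz|zj|->].
- apply/min_idPr; rewrite le_max; apply/orP; left.
  rewrite lerBrDl -base_mean_succ; apply: le_trans s0.
  by apply: base_mean_homo => //; lia.
- rewrite (max_idPr _) ?(min_idPl _) // subr_le0; apply: le_trans s1 _.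
  by apply: base_mean_homo => //; lia.
- rewrite (max_idPl _) ?subr_ge0 //; apply/min_idPl.
  by rewrite lerBlDl -base_mean_succ.
Qed.

(* As a function of the height s, the weight at level j is a trapezoid: it
   rises while s crosses the step of index j - (k+1) and falls while s crosses
   the step of index j.  It depends on the class sums and the mean only. *)
Lemma weight_ramp z w j : (forall i, 0 <= w i) ->
  ramp (csum z w) (mean z w) (j - k.+1%:Z) - ramp (csum z w) (mean z w) j =
  if z <= j <= z + k.+1%:Z then k.+1%:R * w (res k.+1 j) else 0.
Proof.
move=> w0; have u0 := csum_ge0 z w0; have sz := mean_window z w0.
rewrite !(ramp_val _ u0 sz).
have mE : mean z w - base_mean z (csum z w) = k.+1%:R * top_weight z w.
  by rewrite mean_base addrC addKr.
have perU : res k (j - k.+1%:Z) = res k j by rewrite -res_add_period subrK.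
rewrite perU mE; case: (boolP (z <= j <= z + k.+1%:Z)) => jz.
  rewrite [w _](spreadE z) /spread height_res //.
  case: (eqVneq j (z + k.+1%:Z)) => [->|jt].
    rewrite addrK ltxx eqxx; case: (ltgtP (z + k.+1%:Z) z); try by lia.
    by rewrite subr0.
  case: (eqVneq j z) => [->|jb].
    by rewrite ltxx mulrBr; case: (ltP (z - k.+1%:Z) z) => //; lia.
  by case: (ltP (j - k.+1%:Z) z); case: (ltP j z); rewrite ?subr0 //; lia.
case: (ltgtP (j - k.+1%:Z) z); case: (ltgtP j z); rewrite ?subrr //; lia.
Qed.

(** Both families have the same ramps. At the height of a nonzero weight the difference of ramps is
    nonzero, so this height lies in the second window too and carries the same weight there. *)
Lemma weight_unique z z' w w' :
  (forall i, 0 <= w i) -> (forall i, 0 <= w' i) ->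
  csum z w =1 csum z' w' -> mean z w = mean z' w' ->
  forall i, w i != 0 -> height z i = height z' i /\ w i = w' i.
Proof.
move=> w0 w0' eu es i wi; have k0 : k.+1%:R != 0 :> R by rewrite pnatr_eq0.
have := weight_ramp z (height z i) w0; have := weight_ramp z' (height z i) w0'.
have eb j : base_mean j (csum z w) = base_mean j (csum z' w').
  exact: eq_base_mean.
rewrite {1 2}/ramp -!eb -!eu -es -/(ramp (csum z w) (mean z w) _).
rewrite -/(ramp (csum z w) (mean z w) _) => -> .
rewrite height_bounds res_height; case: ifP => [hz /(mulfI k0) ww|_ /eqP].
  by split; [rewrite -{2}(res_height z i) height_res | rewrite ww].
by rewrite eq_sym mulf_eq0 (negPf k0) (negPf wi).
Qed.

Lemma weight_zero z w : csum z w =1 (fun=> 0) -> mean z w = 0 ->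
  forall i, w i = 0.
Proof.
move=> u0; rewrite mean_base (eq_base_mean _ u0) /base_mean big1 => [|o _].
  rewrite add0r => /eqP; rewrite mulf_eq0 pnatr_eq0 /= => /eqP t0 i.
  by rewrite (spreadE z) t0 /spread u0 !if_same subr0 if_same.
by rewrite mul0r.
Qed.

End Hat.

(** * The tower of coloured simplices and its lattice *)

Section Tower.
Variable R : realType.
Implicit Type p : nat -> R.

Lemma ext_pt_lift k (A : 'rV[R]_k) t i : ext_pt A t 0 (lift ord_max i) = A 0 i.
Proof. by rewrite mxE liftK. Qed.

Lemma ext_pt_max k (A : 'rV[R]_k) t : ext_pt A t 0 ord_max = t.
Proof. by rewrite mxE unlift_none. Qed.

Lemma ext_ptP k (x y : 'rV[R]_k.+1) :
  (forall i, x 0 (lift ord_max i) = y 0 (lift ord_max i)) ->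
  x 0 ord_max = y 0 ord_max -> x = y.
Proof. by move=> h1 h2; apply/rowP => i; case: (unliftP ord_max i) => [j|] ->. Qed.

Lemma ext_pt_inj k (A B : 'rV[R]_k) s t : ext_pt A s = ext_pt B t -> A = B /\ s = t.
Proof.
move=> E; split; last by rewrite -(ext_pt_max A s) E ext_pt_max.
by apply/rowP => i; rewrite -(ext_pt_lift A s) E ext_pt_lift.
Qed.

Lemma ext_pt_surj k (x : 'rV[R]_k.+1) :
  x = ext_pt (\row_i x 0 (lift ord_max i)) (x 0 ord_max).
Proof.
by apply: ext_ptP => [i|]; rewrite ?ext_pt_lift ?ext_pt_max ?mxE.
Qed.

Lemma ext_pt_sum (I : finType) k (w : I -> R) (A : I -> 'rV[R]_k) t :
  \sum_i w i *: ext_pt (A i) (t i) = ext_pt (\sum_i w i *: A i) (\sum_i w i * t i).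
Proof.
apply: ext_ptP => [j|]; rewrite ?ext_pt_lift ?ext_pt_max !summxE.
  by apply: eq_bigr => i _; rewrite !mxE liftK.
by apply: eq_bigr => i _; rewrite !mxE unlift_none.
Qed.

(** Splits a step of the construction into a combination in the base, left to induction, and a
    one-dimensional problem for the mean. *)
Lemma L_simplex_comb k (V : 'I_k.+1 -> 'rV[R]_k) pm z (w : 'I_k.+2 -> R) :
  \sum_i w i *: L_simplex V pm z i =
  ext_pt (\sum_c csum z w c *: V c) (mean z w * pm).
Proof.
rewrite /L_simplex /B_pt ext_pt_sum; congr ext_pt.
  rewrite (partition_big (fun i => res k (height z i)) predT) //=.
  by apply: eq_bigr => c _; rewrite scaler_suml; apply: eq_bigr => i /eqP <-.
by rewrite mulr_suml; apply: eq_bigr => i _; rewrite mulrA.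
Qed.

(** The construction started from the single point of dimension 0, so that the segments of dimension
    1 become an ordinary step and inductions start trivially. *)
Fixpoint tower p m : set ('I_m.+1 -> 'rV[R]_m) :=
  if m is k.+1 then T_step (@tower p k) (p k) else setT.

Lemma T_tower p m : @T R p m.+1 = @tower p m.+1.
Proof.
elim: m => [|m IHm]; last by rewrite [LHS]/= -/(@T R p m.+1) IHm.
apply/seteqP; split=> W /= [].
  move=> z ->; exists (fun=> 0), z; split=> //; apply/funext => i.
  by apply/rowP => j; rewrite /L_simplex /B_pt !mxE; case: unliftP => // -[].
move=> V [z [_ ->]]; exists z; apply/funext => i.
by apply/rowP => j; rewrite /L_simplex /B_pt !mxE; case: unliftP => // -[].
Qed.

Lemma tower_aff_indep p m : (forall i, (i < m)%N -> p i != 0) ->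
  forall V, @tower p m V -> aff_indep V.
Proof.
elim: m => [_ V _ w|m IHm p0 _ [V [z [TV ->]]] w].
  by rewrite big_ord1 => w0 _ i; rewrite ord1.
rewrite L_simplex_comb => w0; rewrite -(_ : ext_pt 0 0 = 0); last first.
  by apply/rowP => i; rewrite !mxE; case: unliftP => [j|] _ //; rewrite mxE.
case/ext_pt_inj => uV /eqP; rewrite mulf_eq0 (negPf (p0 m _)) // orbF => /eqP s0.
apply: (weight_zero (z := z)) => // c.
apply: (IHm _ V TV) => //; first by move=> i im; apply: p0; rewrite ltnS ltnW.
by rewrite sum_csum.
Qed.

Lemma tower_cover p m : (forall i, (i < m)%N -> p i != 0) ->
  forall x, exists V, @tower p m V /\ hull V x.
Proof.
elim: m => [_ x|m IHm p0 x].
  exists (fun=> 0); split=> //; exists (fun=> 1); split=> [i|]; first exact: ler01.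
  by rewrite !big_ord1; split=> //; apply/rowP => -[].
have pm : p m != 0 by exact: p0.
have [|V [TV [u [u0 [u1 xu]]]]] := IHm _ (\row_i x 0 (lift ord_max i)).
  by move=> i im; apply: p0; rewrite ltnS ltnW.
pose s := x 0 ord_max / p m.
have [z /andP[sz sz1]] := base_mean_window s u0 u1.
(* The top weight for which [spread z u t] has mean [s]. *)
pose t := (s - base_mean z u) / m.+1%:R.
have tE : m.+1%:R * t = s - base_mean z u.
  by rewrite mulrC divfK // pnatr_eq0.
exists (L_simplex V (p m) z); split; first by exists V, z.
exists (spread z u t); split.
  apply: spread_ge0 => //; apply/andP; split.
    by rewrite divr_ge0 // subr_ge0.
  by rewrite -(@ler_pM2l _ m.+1%:R) ?ltr0n // tE lerBlDl -base_mean_succ.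
split; first by rewrite sum_spread.
rewrite L_simplex_comb mean_spread tE addrC subrK divfK // [LHS]ext_pt_surj.
by rewrite xu; congr ext_pt; apply: eq_bigr => c _; rewrite csum_spread.
Qed.

(** Weights are global functions of the point: by induction its projection fixes the class sums, and
    its last coordinate fixes the mean. *)
Lemma tower_weight_unique p m : (forall i, (i < m)%N -> p i != 0) ->
  forall V W, @tower p m V -> @tower p m W ->
  forall w w', (forall i, 0 <= w i) -> (forall i, 0 <= w' i) ->
  \sum_i w i = \sum_i w' i -> \sum_i w i *: V i = \sum_i w' i *: W i ->
  forall i, w i = w' i /\ (w i != 0 -> V i = W i).
Proof.
elim: m => [_ V W _ _ w w' _ _|m IHm p0 _ _ [V [z [TV ->]]] [W [y [TW ->]]]].
  rewrite !big_ord1 => ww _ i; rewrite ord1; split=> // _.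
  by apply/rowP => -[].
move=> w w' w0 w0' ww; rewrite !L_simplex_comb => /ext_pt_inj[eV].
move/(mulIf (p0 m (ltnSn m))) => es.
have pm i : (i < m)%N -> p i != 0 by move=> im; apply: p0; rewrite ltnS ltnW.
have eu1 : \sum_c csum z w c = \sum_c csum y w' c by rewrite !sum_csum.
have IH := IHm pm _ _ TV TW _ _ (csum_ge0 z w0) (csum_ge0 y w0') eu1 eV.
have eu c := (IH c).1; have VW c := (IH c).2; move=> i.
have nz j : w j != 0 -> height z j = height y j /\ w j = w' j.
  exact: weight_unique.
have nz' j : w' j != 0 -> height y j = height z j /\ w' j = w j.
  by apply: weight_unique => // c; rewrite eu.
have wE : w i = w' i.
  have [wi0|/nz[_ //]] := eqVneq (w i) 0.
  by have [->//|/nz'[_ ->]] := eqVneq (w' i) 0.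
split=> // wi; have [hE _] := nz _ wi.
rewrite /L_simplex /B_pt -/(height z i) -/(height y i) -hE.
(* The class of [i] has a positive sum, so the induction hypothesis identifies the base vertices. *)
congr ext_pt; apply: VW; rewrite gt_eqF // /csum.
rewrite (bigD1 i) //= ltr_pwDl //; last exact: sumr_ge0.
by rewrite lt0r wi w0.
Qed.

(** In positive dimension [c] is the last coordinate in units of the last [p]. Modulo [m+1] it
    extends the vertex colouring to the lattice and restricts the heights of the next step. *)
Fixpoint lattice p m : int -> 'rV[R]_m -> Prop :=
  if m is k.+1 then fun c x => exists y c',
    [/\ lattice p c' y, (c = c' %[mod k.+1%:Z])%Z & x = ext_pt y (c%:~R * p k)]
  else fun _ _ => True.

Lemma lattice_comb p m V : @tower p m V -> forall k : 'I_m.+1 -> int,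
  exists c, lattice p c (\sum_i (k i)%:~R *: V i) /\
    (c = \sum_(i < m.+1) k i * i%:Z %[mod m.+1%:Z])%Z.
Proof.
elim: m V => [V _ k|m IHm _ [V [z [TV ->]]] k].
  by exists 0; split=> //; rewrite !modz1.
have [c [lc cE]] := IHm V TV (csum z k).
exists (mean z k); split; last first.
  rewrite /mean; apply/eqP; rewrite eqz_mod_dvd -sumrB.
  apply: rpred_sum => i _; rewrite -mulrBr intz dvdz_mull //.
  by rewrite -eqz_mod_dvd height_mod.
rewrite L_simplex_comb /=.
exists (\sum_i (csum z k i)%:~R *: V i), c; split=> //.
  rewrite cE /mean; apply/eqP; rewrite eqz_mod_dvd.
  rewrite (partition_big (fun i => res m (height z i)) predT) //= -sumrB.
  apply: rpred_sum => i _; rewrite mulr_suml -sumrB; apply: rpred_sum => j /eqP <-.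
  rewrite -mulrBr intz dvdz_mull // -eqz_mod_dvd res_val.
  by rewrite modz_mod.
congr ext_pt; first by apply: eq_bigr => i _; rewrite /csum rmorph_sum.
by congr (_ * _); rewrite /mean rmorph_sum /=; apply: eq_bigr => i _;
  rewrite rmorphM /= intz.
Qed.

(** The sum [q] is free: with [q = n] the lattice is expressed in the coordinates of the simplex
    enlarged [n] times. *)
Lemma comb_lattice p m V : @tower p m V -> forall (q c : int) x, lattice p c x ->
  exists k : 'I_m.+1 -> int,
  [/\ \sum_i k i = q, x = \sum_i (k i)%:~R *: V i &
    (c = \sum_(i < m.+1) k i * i%:Z %[mod m.+1%:Z])%Z].
Proof.
elim: m V => [V _ q c x _|m IHm _ [V [z [TV ->]]] q c x].
  exists (fun=> q); rewrite !big_ord1; split=> //; last by rewrite !modz1.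
  by apply/rowP => -[].
case=> y [c' [ly cc' ->]].
have [u [uq yu c'u]] := IHm V TV q c' y ly.
(* Modulo [m+1], both [c] and the base mean are congruent to the colour sum of [u], so the top
   coefficient is an integer. *)
have [t tE] : exists t, c = base_mean z u + m.+1%:R * t.
  suff /dvdzP[t tE] : (m.+1%:Z %| c - base_mean z u)%Z.
    by exists t; rewrite natz mulrC -tE addrC subrK.
  rewrite -eqz_mod_dvd cc' c'u /base_mean (sum_res z) eqz_mod_dvd -sumrB.
  apply: rpred_sum => o _; rewrite -mulrBr intz dvdz_mull //.
  by rewrite -eqz_mod_dvd res_val modz_mod.
have csE : mean z (spread z u t) = c by rewrite mean_spread tE.
exists (spread z u t); split; first by rewrite sum_spread.
  rewrite L_simplex_comb yu; congr ext_pt.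
    by apply: eq_bigr => i _; rewrite /csum -rmorph_sum -/(csum _ _ _) csum_spread.
  rewrite -csE /mean rmorph_sum /=; congr (_ * _); apply: eq_bigr => i _.
  by rewrite rmorphM /= intz.
rewrite -csE /mean; apply/eqP; rewrite eqz_mod_dvd -sumrB.
apply: rpred_sum => i _; rewrite -mulrBr intz dvdz_mull //.
by rewrite -eqz_mod_dvd height_mod.
Qed.

End Tower.

(** * Fundamental cells of the lattice *)

Section Cells.
Variable R : realType.
Implicit Type p : nat -> R.

(** From dimension [m] to [m+1], the heights over a fixed lattice point form a progression of step
    [(m+1) p m], to which the last coordinate is rounded down. *)
Lemma lattice_cell_exists p m : (forall i, (i < m)%N -> p i != 0) ->
  forall x : 'rV[R]_m, exists c y, lattice p c y /\
    forall i : 'I_m, 0 <= x 0 i - y 0 i <= i.+1%:R * `|p i|.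
Proof.
elim: m => [_ x|m IHm p0 x]; first by exists 0, 0; split=> // -[].
have pm0 : p m != 0 by exact: p0.
have [|c [y [ly yx]]] := IHm _ (\row_i x 0 (lift ord_max i)).
  by move=> i im; apply: p0; rewrite ltnS ltnW.
pose h := m.+1%:R * `|p m|; pose r := (x 0 ord_max - c%:~R * p m) / h.
have h0 : 0 < h by rewrite mulr_gt0 ?ltr0n // normr_gt0.
pose q : int := if 0 < p m then Num.floor r else - Num.floor r.
have qE : q%:~R * p m = (Num.floor r)%:~R * `|p m|.
  rewrite /q; case: ltP => [p_gt0|p_le0]; first by rewrite gtr0_norm.
  by rewrite ler0_norm // mulrN rmorphN mulNr.
exists (c + m.+1%:Z * q), (ext_pt y ((c + m.+1%:Z * q)%:~R * p m)).
split; first by exists y, c; split=> //; rewrite addrC mulrC modzMDl.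
move=> i; case: (unliftP ord_max i) => [j ->|->].
  by rewrite ext_pt_lift lift_max; have := yx j; rewrite mxE.
rewrite ext_pt_max -/h.
have -> : x 0 ord_max - (c + m.+1%:Z * q)%:~R * p m = h * (r - (Num.floor r)%:~R).
  rewrite mulrBr (mulrC h r) divfK ?gt_eqF // rmorphD rmorphM /= mulrDl -mulrA qE.
  by rewrite /h -pmulrn; ring.
have := floor_le r; have := floorD1_gt r; rewrite rmorphD /= => r1 r0.
rewrite mulr_ge0 ?(ltW h0) ?subr_ge0 //= -[leRHS]mulr1 ler_pM2l //.
by rewrite lerBlDl ltW.
Qed.

(** Once the base points agree, the two heights differ by a multiple of [m+1] that is less than
    [m+1] in absolute value. *)
Lemma lattice_cell_unique p m : (forall i, (i < m)%N -> p i != 0) ->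
  forall c c' (x x' : 'rV[R]_m), lattice p c x -> lattice p c' x' ->
  (forall i : 'I_m, `|x 0 i - x' 0 i| < i.+1%:R * `|p i|) ->
  x = x' /\ (c = c' %[mod m.+1%:Z])%Z.
Proof.
elim: m => [_ c c' x x' _ _ _|m IHm p0 c c' x x'].
  by rewrite !modz1; split=> //; apply/rowP => -[].
case=> y [b [ly cb ->]] [y' [b' [ly' cb' ->]]] h.
have [||<- bb] := IHm _ _ _ _ _ ly ly'.
- by move=> i im; apply: p0; rewrite ltnS ltnW.
- by move=> i; have := h (lift ord_max i); rewrite !ext_pt_lift lift_max.
suff -> : c = c' by [].
have := h ord_max; rewrite !ext_pt_max -mulrBl normrM ltr_pM2r; last first.
  by rewrite normr_gt0 p0.
rewrite -rmorphB /= -intr_norm -[m.+1%:R]/(m.+1%:Z%:~R) ltr_int => cc.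
have : (m.+1%:Z %| c - c')%Z by rewrite -eqz_mod_dvd cb cb' bb.
case/dvdzP => t tE; move: cc; rewrite tE.
have [t0|t0] := eqVneq t 0.
  by move=> _; apply/eqP; rewrite -subr_eq0 tE t0 mul0r.
by rewrite normrM; nia.
Qed.

End Cells.

(** * Barycentric coordinates *)

Section Barycentric.
Import numFieldNormedType.Exports.
Variables (R : realType) (m : nat) (V : 'I_m.+1 -> 'rV[R]_m).

Definition bary_mx : 'M[R]_m.+1 := \matrix_i ext_pt (V i) 1.

Lemma mul_bary_mx (c : 'rV[R]_m.+1) :
  c *m bary_mx = ext_pt (\sum_i c 0 i *: V i) (\sum_i c 0 i).
Proof.
have -> : \sum_i c 0 i = \sum_i c 0 i * 1 by apply: eq_bigr => i; rewrite mulr1.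
rewrite -ext_pt_sum mulmx_sum_row; apply: eq_bigr => i _.
by rewrite rowK.
Qed.

Hypothesis indepV : aff_indep V.

Lemma bary_mx_unit : bary_mx \in unitmx.
Proof.
rewrite -row_free_unit; apply: inj_row_free => c; rewrite mul_bary_mx => c0.
have [cV cs] : \sum_i c 0 i *: V i = 0 /\ \sum_i c 0 i = 0.
  apply: ext_pt_inj; rewrite c0; apply/rowP => i; rewrite !mxE.
  by case: unliftP => // j _; rewrite mxE.
by apply/rowP => i; rewrite mxE; exact: (indepV cs cV).
Qed.

Lemma bary_exists (x : 'rV[R]_m) :
  exists b : 'I_m.+1 -> R, \sum_i b i = 1 /\ x = \sum_i b i *: V i.
Proof.
exists ((ext_pt x 1 *m invmx bary_mx) 0).
have := mul_bary_mx (ext_pt x 1 *m invmx bary_mx).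
by rewrite mulmxKV ?bary_mx_unit // => /ext_pt_inj[].
Qed.

Lemma bary_unique (b b' : 'I_m.+1 -> R) : \sum_i b i = \sum_i b' i ->
  \sum_i b i *: V i = \sum_i b' i *: V i -> b =1 b'.
Proof.
move=> s1 s2 i; apply/eqP; rewrite -subr_eq0; apply/eqP.
apply: (indepV (w := fun i => b i - b' i)); first by rewrite sumrB s1 subrr.
by under eq_bigr do rewrite scalerBl; rewrite sumrB s2 subrr.
Qed.

(** The inverse of the homogeneous matrix recovers the coefficients from the vector; the sum of its
    absolute entries bounds them. *)
Lemma bary_bound : exists2 C : R, 0 <= C &
  forall (b : 'I_m.+1 -> R) (e : R), \sum_i b i = 0 -> 0 <= e ->
  (forall l, `|(\sum_i b i *: V i) 0 l| <= e) -> forall i, `|b i| <= C * e.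
Proof.
exists (\sum_i \sum_j `|invmx bary_mx i j|).
  by apply: sumr_ge0 => i _; apply: sumr_ge0.
move=> b e s0 e0 be i; pose c : 'rV_m.+1 := \row_i b i.
have cE : c *m bary_mx = ext_pt (\sum_i b i *: V i) 0.
  rewrite mul_bary_mx; congr ext_pt; [|rewrite -[RHS]s0];
    by apply: eq_bigr => j _; rewrite mxE.
have -> : b i = (ext_pt (\sum_i b i *: V i) 0 *m invmx bary_mx) 0 i.
  by rewrite -cE mulmxK ?bary_mx_unit // mxE.
rewrite mxE mulr_suml; apply: le_trans (ler_norm_sum _ _ _) _.
apply: ler_sum => j _; rewrite normrM mulrC; apply: ler_pM => //.
  by rewrite (bigD1 i) //= lerDl sumr_ge0.
by case: (unliftP ord_max j) => [l ->|->];
  rewrite ?ext_pt_lift ?be // ext_pt_max normr0.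
Qed.

(** A point outside has a negative barycentric coordinate, which stays negative nearby. *)
Lemma hull_closed : closed (hull V : set 'rV[R]_m).
Proof.
rewrite -[hull V]setCK; apply: open_closedC; rewrite openE => x /= xV.
have [b [b1 xb]] := bary_exists x; have [C C0 bC] := bary_bound.
have [i bi] : exists i, b i < 0.
  apply: contrapT => nb; apply: xV; exists b; split=> // i.
  by rewrite leNgt; apply/negP => bi; apply: nb; exists i.
(* Within this radius coordinate [i] moves by at most [C / (C + 1)] times [- b i], too little to
   reach zero. *)
apply/nbhs_ballP; exists (- b i / (C + 1)).
  by rewrite /= divr_gt0 ?oppr_gt0 // ltr_wpDl.
move=> y [_ xy] [w [w0 [w1 yw]]].
have := bC (fun j => w j - b j) (- b i / (C + 1)).
rewrite sumrB w1 b1 subrr => /(_ erefl).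
have e0 : 0 <= - b i / (C + 1) by rewrite divr_ge0 ?oppr_ge0 ?ltW // ltr_wpDl.
move=> /(_ e0) h; have {h} : `|w i - b i| <= C * (- b i / (C + 1)).
  apply: h => l; under eq_bigr do rewrite scalerBl.
  rewrite sumrB -yw -xb !mxE distrC; apply/ltW; exact: xy.
apply/negP; rewrite -ltNge; apply: lt_le_trans (_ : - b i <= _).
  rewrite mulrA ltr_pdivrMr ?ltr_wpDl // mulrC ltr_pM2l ?oppr_gt0 //.
  by rewrite ltrDl.
by apply: le_trans (ler_norm _); rewrite lerDr.
Qed.

Lemma hull_compact : compact (hull V : set 'rV[R]_m).
Proof.
pose B := \sum_i \sum_l `|V i 0 l|.
have cB : compact [set x : 'rV[R]_m | forall l, `[- B, B]%classic (x ord0 l)].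
  by apply: (@rV_compact R m (fun=> `[- B, B]%classic)) => l; exact: segment_compact.
apply: (subclosed_compact hull_closed cB).
move=> x [w [w0 [w1 ->]]] l /=; rewrite in_itv /= -ler_norml summxE.
apply: le_trans (ler_norm_sum _ _ _) _; apply: ler_sum => i _.
rewrite mxE normrM; apply: (@le_trans _ _ `|V i 0 l|).
  rewrite ler_piMl // ger0_norm // -w1 (bigD1 i) //= lerDl.
  exact: sumr_ge0.
by rewrite (bigD1 l) //= lerDl sumr_ge0.
Qed.

(** A small move away from vertex [i] stays in the hull and turns [b i] into [(1 + t) * b i - t],
    which is nonnegative only if [b i] is positive. *)
Lemma interior_hull_gt0 (b : 'I_m.+1 -> R) : \sum_i b i = 1 ->
  interior (hull V : set 'rV[R^o]_m) (\sum_i b i *: V i) -> forall i, 0 < b i.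
Proof.
move=> b1 /nbhs_ballP[e /= e0 eV] i; set x := \sum_i b i *: V i in eV.
pose B := 1 + \sum_l `|(x - V i) 0 l|.
have B0 : 0 < B by rewrite ltr_pwDl // sumr_ge0.
pose t := e / (2 * B); have t0 : 0 < t by rewrite divr_gt0 // mulr_gt0.
have [|w [w0 [w1 xw]]] := eV (x + t *: (x - V i)).
  split=> // o l; rewrite ord1 /ball /= mxE opprD addrA subrr sub0r normrN.
  rewrite mxE normrM gtr0_norm // /t mulrAC ltr_pdivrMr ?mulr_gt0 //.
  rewrite ltr_pM2l //; apply: (@le_lt_trans _ _ B); last by lra.
  by rewrite /B (bigD1 l) //= addrCA lerDl addr_ge0 // sumr_ge0.
clearbody t.
have wE : w =1 (fun j => (1 + t) * b j - t * (j == i)%:R).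
  apply: bary_unique.
    rewrite w1 sumrB -!mulr_sumr b1 (bigD1 i) //= eqxx big1 => [|j /negPf->//].
    by rewrite addr0 !mulr1 addrK.
  rewrite -xw; under [RHS]eq_bigr do rewrite scalerBl -!scalerA.
  rewrite sumrB -!scaler_sumr -/x (bigD1 i) //= eqxx scale1r big1.
    by rewrite addr0 scalerDl scale1r scalerBr addrA.
  by move=> j /negPf->; rewrite scale0r.
have := w0 i; rewrite wE eqxx mulr1 subr_ge0 => tb.
by rewrite -(@pmulr_rgt0 _ (1 + t)) ?(lt_le_trans t0 tb) //; lra.
Qed.

End Barycentric.

(** * Counting lattice points *)

Section Volume.
Variable R : realType.

(** Replacing every [t i] by a common bound leaves a polynomial in one variable, continuous at 0. *)
Lemma prod_perturb d (s : 'I_d -> R) (e : R) : (forall i, 0 <= s i) -> 0 < e ->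
  exists2 dl : R, 0 < dl & forall t : 'I_d -> R, (forall i, 0 <= t i <= dl) ->
    \prod_i (s i + t i) <= \prod_i s i + e.
Proof.
move=> s0 e0; pose P : {poly R} := \prod_i ((s i)%:P + 'X).
have PE (x : R) : P.[x] = \prod_i (s i + x).
  by rewrite horner_prod; apply: eq_bigr => i _; rewrite !hornerE.
have [dl dl0 hdl] := continuous_horner (nbhsx_ballx P.[0] e e0).
exists (dl / 2) => [|t t0]; first by rewrite divr_gt0.
have lt : \prod_i (s i + t i) <= P.[dl / 2].
  rewrite PE; apply: ler_prod => i _; have /andP[ti0 tid] := t0 i.
  by rewrite addr_ge0 // lerD2l.
apply: le_trans lt _.
have : ball P.[0] e P.[dl / 2].
  apply: hdl; rewrite /ball_ /= sub0r normrN gtr0_norm ?divr_gt0 //.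
  by rewrite ltr_pdivrMr // ltr_pMr // ltr1n.
rewrite /ball /= distrC => /(le_lt_trans (ler_norm _)); rewrite ltrBlDl => /ltW.
by rewrite [P.[0]]PE; under eq_bigr do rewrite addr0.
Qed.

Lemma lebesgue_outer_finite d (A : set 'rV[R]_d) (I : finType) (P : pred I)
    (a b : I -> 'rV[R]_d) : (0 < d)%N ->
  (forall i l, a i 0 l <= b i 0 l) ->
  (forall x, A x -> exists2 i, P i & cbox (a i) (b i) x) ->
  (lebesgue_outer A <= (\sum_(i | P i) \prod_l (b i 0 l - a i 0 l))%:E)%E.
Proof.
move=> d0 ab AP; pose L := [seq (a i, b i) | i <- enum P].
(* The finite list is padded with the degenerate box at 0, of volume zero since [0 < d]. *)
pose z := (0 : 'rV[R]_d, 0 : 'rV[R]_d).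
have Lab k : forall l, (nth z L k).1 0 l <= (nth z L k).2 0 l.
  have [kL|kL] := ltnP k (size L); last by rewrite nth_default // => l.
  by have /mapP[i _ ->] := mem_nth z kL; apply: ab.
apply: ereal_inf_lbound; exists (fun k => (nth z L k).1), (fun k => (nth z L k).2).
split=> //; split.
  move=> x /AP[i Pi xi]; exists (index i (enum P)) => //=.
  have iP : i \in enum P by rewrite mem_enum.
  by rewrite /L (nth_map i) ?index_mem // nth_index.
rewrite (nneseries_split 0 (size L)); last first.
  by move=> k _; rewrite lee_fin prodr_ge0 // => l _; rewrite subr_ge0.
rewrite eseries0 => [|k]; last first.
  rewrite add0n => kL _; rewrite nth_default //= (bigD1 (Ordinal d0)) //=.
  by rewrite mxE subrr mul0r.
rewrite adde0 add0n sumEFin; congr EFin.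
rewrite -(big_nth z predT (fun c : 'rV[R]_d * 'rV[R]_d =>
  \prod_l (c.2 0 l - c.1 0 l))).
by rewrite big_map big_enum.
Qed.

Variables (p : nat -> R) (d : nat) (V : 'I_d.+1 -> 'rV[R]_d).
Hypotheses (p_neq0 : forall i, (i < d)%N -> p i != 0) (TV : tower p V).

Let q (i : nat) : R := i.+1%:R * `|p i|.

Lemma cell_gt0 (i : 'I_d) : 0 < q i.
Proof. by rewrite mulr_gt0 ?ltr0n // normr_gt0 p_neq0. Qed.

Lemma cell_volume (e : nat) : \prod_(i < e) q i = e`!%:R * \prod_(i < e) `|p i|.
Proof.
elim: e => [|e IH]; first by rewrite !big_ord0 mulr1.
by rewrite !big_ord_recr /= IH factS natrM /q; ring.
Qed.

Let indepV : aff_indep V := tower_aff_indep p_neq0 TV.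

(** Rounding [n x] down to the lattice changes the coordinates [n * w i] by at most [C * B], so
    coefficients shifted by [E] are nonnegative, with one [E] for all [n]. *)
Lemma hull_cell_cover : exists E : nat, forall n : nat, (0 < n)%N ->
  forall x, hull V x -> exists t : 'I_d.+1 -> nat,
    (\sum_i t i = n + E * d.+1)%N /\
    forall l, 0 <= n%:R * x 0 l - (\sum_i ((t i)%:R - E%:R) *: V i) 0 l <= q l.
Proof.
have [C C0 bC] := bary_bound indepV.
pose B := \sum_(l < d) q l.
have qB (l : 'I_d) : q l <= B.
  by rewrite /B (bigD1 l) //= lerDl sumr_ge0 // => i _; apply/ltW/cell_gt0.
have B0 : 0 <= B by rewrite sumr_ge0 // => i _; apply/ltW/cell_gt0.
exists (Num.truncn (C * B)).+1 => n n0 x [w [w0 [w1 xw]]].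
set E := (Num.truncn (C * B)).+1.
have CE : C * B < E%:R by exact: truncnS_gt.
have [c [y [ly yx]]] := lattice_cell_exists p_neq0 (n%:R *: x).
have [k [kn yk _]] := comb_lattice TV n%:Z ly.
have kE i : 0 <= k i + E%:Z.
  have /(_ i) : forall i, `|n%:R * w i - (k i)%:~R| <= C * B.
    apply: bC => //.
      rewrite sumrB -mulr_sumr w1 mulr1 -rmorph_sum /= kn -pmulrn.
      by rewrite subrr.
    move=> l; under eq_bigr do rewrite scalerBl -scalerA.
    rewrite sumrB -scaler_sumr -xw -yk !mxE.
    have := yx l; rewrite mxE => /andP[h0 h1].
    by rewrite ger0_norm //; apply: le_trans h1 (qB l).
  rewrite ler_distl => /andP[_ h].
  have nw : 0 <= n%:R * w i by rewrite mulr_ge0.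
  have : (0 : R) < (k i + E%:Z + 1)%:~R by rewrite !rmorphD /= -pmulrn; lra.
  by rewrite ltr0z; lia.
have tE i : (absz (k i + E%:Z))%:R - E%:R = (k i)%:~R :> R.
  by rewrite natr_absz ger0_norm // rmorphD /= -pmulrn addrK.
exists (fun i => absz (k i + E%:Z)); split.
  apply/eqP; rewrite -(eqr_nat int); apply/eqP.
  rewrite natr_sum; under eq_bigr do rewrite natz gez0_abs //.
  rewrite big_split /= kn sumr_const card_ord natrD natrM !natz.
  by rewrite -mulr_natr natz.
move=> l; have := yx l; rewrite mxE yk.
by under [X in _ -> _ <= _ - (X : 'rV_d) _ _ <= _]eq_bigr do rewrite tE.
Qed.

(** With [N = n + E (d+1)], the [binomial (d+N) d] families of shifted coefficients give cells of
    volume [d! prod |p_i| / n^d] covering the hull. *)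
Lemma hull_outer_le : (0 < d)%N -> exists E : nat, forall n : nat, (0 < n)%N ->
  (lebesgue_outer (hull V) <= (\prod_(i < d) (`|p i| + E%:R / n%:R * `|p i|))%:E)%E.
Proof.
move=> d0; have [E hE] := hull_cell_cover.
(* This is [d + N - n]; the binomial times [d!] is at most [(d + N)^d]. *)
exists (d + E * d.+1)%N => n n0; pose N := (n + E * d.+1)%N.
have n0R : 0 < n%:R :> R by rewrite ltr0n.
pose S := [set t : d.+1.-tuple 'I_N.+1 | (\sum_(i <- t) i == N)%N]%SET.
pose a (t : d.+1.-tuple 'I_N.+1) : 'rV[R]_d :=
  n%:R^-1 *: \sum_i ((tnth t i)%:R - E%:R) *: V i.
pose b t : 'rV[R]_d := a t + n%:R^-1 *: \row_l q l.
have ba t l : b t 0 l - a t 0 l = q l / n%:R.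
  by rewrite /b [_ 0 l]mxE addrAC subrr add0r !mxE mulrC.
have outer : (lebesgue_outer (hull V) <=
    (\sum_(t in S) \prod_l (b t 0 l - a t 0 l))%:E)%E.
  have hab t l : a t 0 l <= b t 0 l.
    by rewrite -subr_ge0 ba divr_ge0 // ltW // cell_gt0.
  have hcov x : hull V x -> exists2 t, t \in S & cbox (a t) (b t) x.
    move=> /(hE n n0)[t [tN tx]].
    have tle i : (t i < N.+1)%N.
      by rewrite ltnS /N -tN (bigD1 i) //= leq_addr.
    exists [tuple inord (t i) | i < d.+1].
      rewrite inE big_tuple; apply/eqP; rewrite -[RHS]tN.
      by apply: eq_bigr => i _; rewrite tnth_mktuple inordK.
    move=> l; set u := [tuple _ | _ < _].
    have uE : a u = n%:R^-1 *: \sum_i ((t i)%:R - E%:R) *: V i.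
      congr (_ *: _); apply: eq_bigr => i _.
      by rewrite tnth_mktuple inordK.
    pose y := (\sum_i ((t i)%:R - E%:R) *: V i) 0 l.
    have /andP[h0 h1] : 0 <= n%:R * x 0 l - y <= q l := tx l.
    have aE : a u 0 l = y / n%:R by rewrite uE mxE mulrC.
    have bE : b u 0 l = (y + q l) / n%:R by rewrite mulrDl -(ba u) aE addrC subrK.
    rewrite aE bE ler_pdivrMr // ler_pdivlMr // -lerBlDl mulrC h1 andbT.
    by rewrite -subr_ge0.
  exact: lebesgue_outer_finite.
apply: le_trans outer _; rewrite lee_fin.
under eq_bigr do under eq_bigr do rewrite ba.
rewrite sumr_const prodf_div card_ord_partitions prodr_const card_ord.
rewrite cell_volume -[leLHS]mulr_natr.
have -> : \prod_(i < d) (`|p i| + (d + E * d.+1)%:R / n%:R * `|p i|) =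
    \prod_(i < d) `|p i| * ((d + N)%:R ^+ d / n%:R ^+ d).
  have prodc (c : R) : \prod_(i < d) c = c ^+ d by rewrite prodr_const card_ord.
  rewrite -exprVn -exprMn -prodc -big_split /=.
  apply: eq_bigr => i _; rewrite /N addnCA natrD.
  by field; rewrite gt_eqF.
set P := \prod_(i < d) `|p i|.
have P0 : 0 < P by apply: prodr_gt0 => i _; rewrite normr_gt0 p_neq0.
have -> : d`!%:R * P / n%:R ^+ d * 'C(d + N, d)%:R =
    P * (('C(d + N, d) * d`!)%:R / n%:R ^+ d) by rewrite natrM; ring.
rewrite ler_pM2l // ler_pM2r ?invr_gt0 ?exprn_gt0 // -natrX ler_nat.
have prodn (c : nat) : (\prod_(i < d) c = c ^ d)%N.
  by rewrite prod_nat_const card_ord.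
rewrite bin_ffact ffact_prod -prodn.
by apply: leq_prod => i _; exact: leq_subr.
Qed.

(** A point is located by its cell index in each direction. Two lattice points with equal indices
    coincide by uniqueness in cells, and then so do their coefficients. *)
Lemma box_lattice_count (n : nat) (a b : 'rV[R]_d) : (0 < n)%N ->
  (forall l, a 0 l <= b 0 l) ->
  (#|[set t : d.+1.-tuple 'I_n.+1 | (\sum_(i <- t) i == n)%N &
      `[< cbox a b (n%:R^-1 *: \sum_i (tnth t i)%:R *: V i)%R >]]%SET| <=
   \prod_(l < d) (Num.truncn (n%:R * (b 0 l - a 0 l) / q l)%R).+1)%N.
Proof.
move=> n0 ab; set S := [set t | _ & _]%SET.
have n0R : 0 < n%:R :> R by rewrite ltr0n.
pose M l := Num.truncn (n%:R * (b 0 l - a 0 l) / q l).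
pose pt (t : d.+1.-tuple 'I_n.+1) := \sum_i (tnth t i)%:R *: V i.
pose r t (l : 'I_d) := (pt t 0 l - n%:R * a 0 l) / q l.
have rS t : t \in S -> forall l, 0 <= r t l <= n%:R * (b 0 l - a 0 l) / q l.
  rewrite inE => /andP[_ /asboolP tb] l; have := tb l; rewrite mxE -/(pt t).
  rewrite ler_pdivlMl // ler_pdivrMl // => /andP[h0 h1]; apply/andP; split.
    by rewrite divr_ge0 ?subr_ge0 // ltW // cell_gt0.
  by rewrite ler_pM2r ?invr_gt0 ?cell_gt0 // mulrBr lerD2r.
pose f t : {dffun forall l : 'I_d, 'I_(M l).+1} :=
  [ffun l : 'I_d => inord (Num.truncn (r t l)) : 'I_(M l).+1].
have fE t : t \in S -> forall l, f t l = Num.truncn (r t l) :> nat.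
  move=> tS l; have /andP[h0 h1] := rS t tS l.
  by rewrite ffunE inordK // ltnS le_truncn.
have f_inj : {in S &, injective f}.
  move=> t t' tS t'S ft.
  have [c [lc _]] := lattice_comb TV (fun i => (tnth t i)%:Z).
  have [c' [lc' _]] := lattice_comb TV (fun i => (tnth t' i)%:Z).
  have [|e _] := lattice_cell_unique p_neq0 lc lc'.
    move=> l; under eq_bigr do rewrite -pmulrn.
    under [X in `|_ - (X : 'rV_d) _ _| < _]eq_bigr do rewrite -pmulrn.
    rewrite -/(pt t) -/(pt t') -/(q l).
    have -> : pt t 0 l - pt t' 0 l = q l * (r t l - r t' l).
      by rewrite /r; field; rewrite gt_eqF ?cell_gt0.
    rewrite normrM gtr0_norm ?cell_gt0 // gtr_pMr ?cell_gt0 //.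
    have /andP[/truncn_itv h1 _] := rS t tS l.
    have /andP[/truncn_itv h2 _] := rS t' t'S l.
    rewrite -(fE t tS) ft (fE t' t'S) -natr1 in h1; rewrite -natr1 in h2.
    by rewrite ltr_norml; lra.
  apply: eq_from_tnth => i; apply/val_inj/eqP; rewrite -(eqr_nat R); apply/eqP.
  move: i; apply: (bary_unique indepV); last exact: e.
  rewrite -!natr_sum; congr _%:R; rewrite -!(big_tuple _ _ _ predT) /=.
  by move: tS t'S; rewrite !inE => /andP[/eqP-> _] /andP[/eqP-> _].
rewrite -(card_in_imset f_inj).
pose X := setXn (fun l : 'I_d => [set: 'I_(M l).+1]%SET).
apply: (@leq_trans #|X|); last first.
  by rewrite cardsXn; apply: leq_prod => l _; rewrite cardsT card_ord.
by apply/subset_leq_card/fintype.subsetP => g _; apply/setXnP => l; rewrite inE.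
Qed.

(** The points of the simplex with coordinates in multiples of [1/n] all lie in the boxes. Counting
    per box and multiplying by the cell volume leaves [q l / n] as boundary term. *)
Lemma box_cover_volume (n : nat) (K : seq nat) (a b : nat -> 'rV[R]_d) :
  (0 < n)%N -> (forall k l, a k 0 l <= b k 0 l) ->
  (forall x, hull V x -> exists2 k, k \in K & cbox (a k) (b k) x) ->
  \prod_(i < d) `|p i| <=
  \sum_(k <- K) \prod_(l < d) (b k 0 l - a k 0 l + q l / n%:R).
Proof.
move=> n0 ab cov; have n0R : 0 < n%:R :> R by rewrite ltr0n.
pose S := [set t : d.+1.-tuple 'I_n.+1 | (\sum_(i <- t) i == n)%N]%SET.
pose pt (t : d.+1.-tuple 'I_n.+1) : 'rV[R]_d :=
  n%:R^-1 *: \sum_i (tnth t i)%:R *: V i.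
have count : ('C(d + n, d) <= \sum_(k <- K)
    \prod_(l < d) (Num.truncn (n%:R * (b k 0 l - a k 0 l) / q l)%R).+1)%N.
  rewrite -card_ord_partitions -/S.
  apply: (@leq_trans
    (\sum_(k <- K) #|[set t in S | `[< cbox (a k) (b k) (pt t) >]]%SET|)).
    under eq_bigr do rewrite -sum1dep_card big_mkcondr /=.
    rewrite exchange_big /= -sum1_card; apply: leq_sum => t tS.
    have [|k kK ktx] := cov (pt t).
      exists (fun i => (tnth t i)%:R / n%:R); split.
        by move=> i; rewrite divr_ge0.
      split.
        rewrite -mulr_suml -natr_sum -(big_tuple _ _ _ predT (fun i => nat_of_ord i)).
        by move: tS; rewrite inE => /eqP->; rewrite divff // gt_eqF.
      by rewrite /pt scaler_sumr; apply: eq_bigr => i _; rewrite scalerA mulrC.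
    by rewrite (big_rem k) //= (asboolT ktx).
  apply: leq_sum => k _.
  have := box_lattice_count n0 (ab k); apply: leq_trans.
  by apply/subset_leq_card/fintype.subsetP => t; rewrite !inE.
pose c := \prod_(l < d) (q l / n%:R).
have c0 : 0 < c by apply: prodr_gt0 => l _; rewrite divr_gt0 // cell_gt0.
(* The binomial times [d!] is a product of [d] factors, each at least [n]. *)
have c1 : \prod_(i < d) `|p i| <= 'C(d + n, d)%:R * c.
  rewrite /c prodf_div prodr_const card_ord cell_volume.
  set P := \prod_(i < d) `|p i|.
  have P0 : 0 <= P by apply: prodr_ge0.
  have -> : 'C(d + n, d)%:R * (d`!%:R * P / n%:R ^+ d) =
      P * (('C(d + n, d) * d`!)%:R / n%:R ^+ d) by rewrite natrM; ring.
  rewrite ler_peMr // ler_pdivlMr ?exprn_gt0 // mul1r -natrX ler_nat.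
  have prodn (e : nat) : (\prod_(i < d) e = e ^ d)%N.
    by rewrite prod_nat_const card_ord.
  rewrite bin_ffact ffact_prod -prodn; apply: leq_prod => i _.
  by have := ltn_ord i; lia.
apply: le_trans c1 _; move: count; rewrite -(ler_nat R) => count.
apply: le_trans (ler_wpM2r (ltW c0) count) _.
rewrite natr_sum mulr_suml; apply: ler_sum => k _.
rewrite natr_prod /c -big_split /=; apply: ler_prod => l _.
have ql := cell_gt0 l.
apply/andP; split; first by rewrite mulr_ge0 // divr_ge0 // ltW.
have -> : b k 0 l - a k 0 l + q l / n%:R =
    (n%:R * (b k 0 l - a k 0 l) / q l + 1) * (q l / n%:R).
  by field; rewrite !gt_eqF.
rewrite ler_pM2r ?divr_gt0 // -natr1 lerD2r.
have /truncn_itv/andP[//] : 0 <= n%:R * (b k 0 l - a k 0 l) / q l.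
by rewrite divr_ge0 ?(ltW ql) ?mulr_ge0 ?subr_ge0.
Qed.

End Volume.

(** * Outer measure of a simplex *)

Section OuterMeasure.
Import numFieldNormedType.Exports.
Variable R : realType.

Lemma open_box_open d (a b : 'rV[R]_d) :
  open [set x : 'rV[R]_d | forall l, a 0 l < x 0 l < b 0 l].
Proof.
rewrite openE => x xab; rewrite /interior /=.
apply: (@filter_forall _ _ (fun l (y : 'rV[R]_d) => a 0 l < y 0 l < b 0 l)
  (nbhs x) (nbhs_filter x)) => l.
have /andP[al lb] := xab l.
have h : nbhs (x 0 l) [set y : R | a 0 l < y < b 0 l].
  apply: filterS (filterI (open_nbhs_nbhs (conj (@open_gt R (a 0 l)) al))
                          (open_nbhs_nbhs (conj (@open_lt R (b 0 l)) lb))).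
  by move=> y /= [-> ->].
exact: (coord_continuous h).
Qed.

Lemma compact_open_box_cover d (A : set 'rV[R]_d) (a b : nat -> 'rV[R]_d) :
  compact A ->
  A `<=` \bigcup_k [set x : 'rV[R]_d | forall l, a k 0 l < x 0 l < b k 0 l] ->
  exists N, forall x, A x ->
    exists2 k, k \in iota 0 N & forall l, a k 0 l < x 0 l < b k 0 l.
Proof.
rewrite compact_cover => cA Acov.
have [|D _ AD] := cA _ setT _ _ Acov; first by move=> k _; exact: open_box_open.
exists (\max_(k <- finmap.enum_fset D) k).+1 => x /AD[k kD xk]; exists k => //.
by rewrite mem_iota add0n ltnS (leq_bigmax_seq (r := finmap.enum_fset D)).
Qed.

Lemma sum_half_powers (e : R) N :
  \sum_(k <- iota 0 N) e / 2 ^+ k.+1 = e - e / 2 ^+ N.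
Proof.
rewrite -{1}[N]subn0 -/(index_iota 0 N) big_mkord.
elim: N => [|N IH]; first by rewrite big_ord0 expr0 divr1 subrr.
rewrite big_ord_recr /= IH exprS; field.
by rewrite expf_neq0.
Qed.

Lemma nat_divr_le (a e : R) : 0 <= a -> 0 < e ->
  exists2 n : nat, (0 < n)%N & a / n%:R <= e.
Proof.
move=> a0 e0; exists (Num.truncn (a / e)).+1 => //.
by rewrite ler_pdivrMr ?ltr0n // mulrC -ler_pdivrMr // ltW // truncnS_gt.
Qed.

Variables (p : nat -> R) (d : nat) (V : 'I_d.+1 -> 'rV[R]_d).
Hypotheses (p_neq0 : forall i, (i < d)%N -> p i != 0) (TV : tower p V).

(** Box [k] of a countable cover is enlarged at cost at most [e / 2^(k+1)]; compactness leaves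
    finitely many boxes, to which the count applies. *)
Lemma hull_outer_ge : ((\prod_(i < d) `|p i|)%:E <= lebesgue_outer (hull V))%E.
Proof.
apply: le_ereal_inf_tmp => _ [a [b [ab [cov ->]]]].
apply/lee_addgt0Pr => e e0.
have e2 k : 0 < e / 2 ^+ k.+1 by rewrite divr_gt0 // exprn_gt0.
have s0 k l : 0 <= b k 0 l - a k 0 l by rewrite subr_ge0.
have ex k : exists dl : R, 0 < dl /\ forall t : 'I_d -> R,
    (forall i, 0 <= t i <= dl) -> \prod_i (b k 0 i - a k 0 i + t i) <=
      \prod_i (b k 0 i - a k 0 i) + e / 2 ^+ k.+1.
  by have [dl dl0 h] := prod_perturb (s0 k) (e2 k); exists dl.
have [dl hdl] := choice ex; have dl0 k := (hdl k).1; have {}hdl k := (hdl k).2.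
(* A third of [dl k] on each side leaves room for an open box; the last third is kept for the
   boundary term of the count. *)
pose a' k : 'rV[R]_d := \row_l (a k 0 l - dl k / 3).
pose b' k : 'rV[R]_d := \row_l (b k 0 l + dl k / 3).
have [N covN] : exists N, forall x, hull V x ->
    exists2 k, k \in iota 0 N & forall l, a' k 0 l < x 0 l < b' k 0 l.
  apply: compact_open_box_cover; first exact/hull_compact/(tower_aff_indep p_neq0).
  move=> x /cov[k _ xk]; exists k => // l; rewrite !mxE.
  by have := xk l; have := dl0 k; lra.
(* The sum of all ratios of cell sides to thirds: for [n] at least [B] every scaled cell fits in the
   third kept for it. *)
pose B := \sum_(k < N) \sum_(l < d) l.+1%:R * `|p l| / (dl k / 3).
have B0 k l : 0 <= l.+1%:R * `|p l| / (dl k / 3).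
  by rewrite divr_ge0 ?mulr_ge0 // ltW.
have [|n n0 nB] := @nat_divr_le B 1 _ ltr01.
  by apply: sumr_ge0 => k _; apply: sumr_ge0.
have qn k (l : 'I_d) : (k < N)%N -> l.+1%:R * `|p l| / n%:R <= dl k / 3.
  move=> kN; rewrite ler_pdivrMr ?ltr0n // [leRHS]mulrC -ler_pdivrMr ?divr_gt0 //.
  apply: (@le_trans _ _ B); last first.
    by move: nB; rewrite ler_pdivrMr ?ltr0n // mul1r.
  rewrite /B (bigD1 (Ordinal kN)) //= (bigD1 l) //= -addrA lerDl.
  by rewrite addr_ge0 // sumr_ge0 // => i _; rewrite sumr_ge0.
have := box_cover_volume p_neq0 TV n0 (K := iota 0 N) (a := a') (b := b').
have ab' k l : a' k 0 l <= b' k 0 l.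
  by rewrite !mxE; have := ab k l; have := dl0 k; lra.
move=> /(_ ab') h; have {h} : \prod_(i < d) `|p i| <= \sum_(k <- iota 0 N)
    (\prod_i (b k 0 i - a k 0 i) + e / 2 ^+ k.+1).
  apply: le_trans (h _) _.
    by move=> x /covN[k kN xk]; exists k => // l; have /andP[/ltW-> /ltW->] := xk l.
  rewrite big_seq [leRHS]big_seq; apply: ler_sum => k.
  rewrite mem_iota add0n /= => kN.
  pose t (l : 'I_d) := dl k / 3 + dl k / 3 + l.+1%:R * `|p l| / n%:R.
  have <- : \prod_l (b k 0 l - a k 0 l + t l) =
      \prod_(l < d) (b' k 0 l - a' k 0 l + l.+1%:R * `|p l| / n%:R).
    by apply: eq_bigr => l _; rewrite /t !mxE; ring.
  apply: hdl => l; rewrite /t.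
  have := qn k l kN; have := dl0 k.
  have : 0 <= l.+1%:R * `|p l| / n%:R by rewrite divr_ge0 // mulr_ge0.
  lra.
rewrite big_split /= sum_half_powers => h.
apply: (@le_trans _ _ ((\sum_(k <- iota 0 N) \prod_i (b k 0 i - a k 0 i)) + e)%:E).
  rewrite lee_fin; apply: le_trans h _; rewrite lerD2l gerBl.
  by rewrite divr_ge0 ?ltW // exprn_gt0.
rewrite EFinD leeD2r // -sumEFin.
rewrite -{1}[N]subn0; apply: nneseries_lim_ge => k _ _.
by rewrite lee_fin prodr_ge0 // => l _; rewrite subr_ge0.
Qed.

Lemma hull_outer : (0 < d)%N ->
  lebesgue_outer (hull V) = (\prod_(i < d) `|p i|)%:E.
Proof.
move=> d0; apply/eqP; rewrite eq_le hull_outer_ge andbT.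
apply/lee_addgt0Pr => e e0.
have [E hE] := hull_outer_le p_neq0 TV d0.
have [dl dl0 hdl] := @prod_perturb R d (fun i => `|p i|) e (fun=> normr_ge0 _) e0.
have [|n n0 hn] := @nat_divr_le (E%:R * \sum_(i < d) `|p i|) dl _ dl0.
  by rewrite mulr_ge0 // sumr_ge0.
apply: le_trans (hE n n0) _; rewrite -EFinD lee_fin; apply: hdl => i.
rewrite mulr_ge0 ?divr_ge0 //=; apply: le_trans hn.
rewrite mulrAC ler_pM2r ?invr_gt0 ?ltr0n // ler_wpM2l //.
by rewrite (bigD1 i) //= lerDl sumr_ge0.
Qed.

End OuterMeasure.

(** * Tessellation and face-to-face property *)

Section Tessellation.
Variables (R : realType) (p : nat -> R) (d : nat).
Hypothesis p_neq0 : forall i, (i < d)%N -> p i != 0.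
Implicit Types V W : 'I_d.+1 -> 'rV[R]_d.

(** A point interior to [hull V] has only positive weights there, so uniqueness of weights matches
    all vertices. *)
Lemma tower_interior V W : tower p V -> tower p W ->
  interior (hull V : set 'rV[R^o]_d) `&` interior (hull W : set 'rV[R^o]_d) !=set0 ->
  V = W.
Proof.
move=> TV TW [x [xV xW]].
have [w [w0 [w1 xw]]] : hull V x by exact: interior_subset xV.
have [w' [w0' [w1' xw']]] : hull W x by exact: interior_subset xW.
have wpos : forall i, 0 < w i.
  by apply: (interior_hull_gt0 (tower_aff_indep p_neq0 TV) w1); rewrite -xw.
apply/funext => i.
have [|_ h] := tower_weight_unique p_neq0 TV TW w0 w0' _ (etrans (esym xw) xw') i.
  by rewrite w1 w1'.
by apply: h; rewrite gt_eqF.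
Qed.

(** A common point has the same weights in both simplices, and they vanish off the common vertices.
    Vertices are indexed by colour, so they are compared index by index. *)
Lemma tower_face V W : tower p V -> tower p W ->
  hull V `&` hull W = conv_sub V [set i | V i == W i]%SET.
Proof.
move=> TV TW; apply/seteqP; split=> x /=.
  move=> [[w [w0 [w1 xw]]] [w' [w0' [w1' xw']]]].
  exists w; split=> //; split=> // i; rewrite inE => VWi; apply/eqP.
  have [|_ h] := tower_weight_unique p_neq0 TV TW w0 w0' _ (etrans (esym xw) xw') i.
    by rewrite w1 w1'.
  by apply: contraNT VWi => /h ->.
move=> [w [w0 [wI [w1 ->]]]]; split; exists w; split=> //; split=> //.
apply: eq_bigr => i _; have [->//|VWi] := eqVneq (V i) (W i).
by rewrite wI ?scale0r // inE.
Qed.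

Lemma conv_sub_neq0 V I : conv_sub V I !=set0 -> (0 < #|I|)%N.
Proof.
move=> [x [w [_ [wI [w1 _]]]]]; rewrite card_gt0; apply: contra_eq_neq w1 => I0.
by rewrite big1 1?eq_sym ?oner_eq0 // => i _; rewrite wI // I0 inE.
Qed.

Lemma tower_face_to_face V W : tower p V -> tower p W ->
  hull V `&` hull W = set0 \/
  (is_face V (hull V `&` hull W) /\ is_face W (hull V `&` hull W)).
Proof.
move=> TV TW; have [|/set0P] := eqVneq (hull V `&` hull W) set0; first by left.
rewrite {1}tower_face // => /conv_sub_neq0 I0; right.
split; first by exists [set i | V i == W i]%SET; rewrite tower_face.
exists [set i | V i == W i]%SET; split=> //; rewrite setIC tower_face //.
by congr conv_sub; apply/setP => i; rewrite !inE eq_sym.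
Qed.

End Tessellation.

Lemma pext_ord (R : realType) d (p : 'I_d -> R) (i : 'I_d) : pext p i = p i.
Proof. by rewrite /pext valK. Qed.

Theorem theorem1 (R : realType) (d : nat) (p : 'I_d -> R) :
  (0 < d)%N -> (forall i, p i != 0) ->
  simplicial_tessellation (Td p) /\
  (forall V, Td p V -> lebesgue_outer (hull V) = (\prod_i `|p i|)%:E) /\
  (forall F : seq ('I_d.+1 -> 'rV[R]_d),
     (forall V, V \in F -> Td p V) ->
     connected (\bigcup_(V in [set V | V \in F]) hull V : set 'rV[R^o]_d) ->
     face_to_face F).
Proof.
move=> d0 p0.
have pN i : (i < d)%N -> pext p i != 0.
  by move=> id; rewrite -[i]/(nat_of_ord (Ordinal id)) pext_ord.
(* In dimension 0 [T] is empty and [tower] is not; [0 < d] excludes this case. *)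
have -> : Td p = @tower R (pext p) d.
  by case: d d0 p p0 {pN} => // d _ p _; rewrite /Td T_tower.
split; last split.
- split; first exact: tower_aff_indep; split.
    apply/seteqP; split=> // x _; have [V [TV xV]] := tower_cover pN x.
    by exists V.
  move=> V W TV TW VW; apply/eqP/negP => /negP/set0P/(tower_interior pN TV TW) E.
  by apply: VW; rewrite E.
- move=> V TV; rewrite (hull_outer pN TV d0); congr EFin.
  by apply: eq_bigr => i _; rewrite pext_ord.
- by move=> F TF _ V W /TF TV /TF TW; exact: tower_face_to_face pN _ _ TV TW.
Qed.
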